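(* Let $d\ge 1$, let $f$ be an almost radial decreasing density on $\mathbb{R}^d$, and let $\theta\in\mathbb{S}^{d-1}$ and $\gamma\ge0$ be such that $$\lim_{t\to\infty}\frac{f(t\theta-y)}{f(t\theta)} = e^{\gamma(\theta\cdot y)}\quad\text{for every } y\in\mathbb{R}^d .$$ Then $f\in\mathscr{S}_d(\theta,\gamma)$ if and only if $\lim_{r\to\infty}K_f(r)=0$.
   Context: A density is a non-negative, non-zero function $f\in L^1(\mathbb{R}^d)$ (with respect to Lebesgue measure; $f$ is a function defined pointwise). $\mathbb{S}^{d-1}$ is the unit sphere of $\mathbb{R}^d$. A function $g$ on $(0,\infty)$ is decreasing if $g(s)\ge g(t)$ whenever $s\le t$ (no strictness required). A density $f$ is almost radial decreasing if there are a decreasing function $g:(0,\infty)\to(0,\infty)$ and a constant $c\ge1$ with $c^{-1}g(|x|)\le f(x)\le c\,g(|x|)$ for all $x\in\mathbb{R}^d\setminus\{0\}$. For $r>0$, $$K_f(r):=\sup_{|x|\ge 1}\ \int_{\{y:\ |x-y|>r,\ |y|>r\}} \frac{f(x-y)f(y)}{f(x)}\,dy\in[0,\infty].$$ Definition of $\mathscr{S}_d(\theta,\gamma)$: let $f\in L^1(\mathbb{R}^d)$, $f\ge0$, with $f(t\theta)>0$ for all $t\ge t_0$, for some $t_0>0$. Then $f\in\mathscr{S}_d(\theta,\gamma)$ if (i) $\lim_{t\to\infty} f(t\theta-y)/f(t\theta)=e^{\gamma(\theta\cdot y)}$ for every $y\in\mathbb{R}^d$, and (ii) $h(\theta):=\int_{\mathbb{R}^d}e^{\gamma(\theta\cdot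 y)}f(y)\,dy<\infty$ and $\lim_{t\to\infty}f^{2\star}(t\theta)/f(t\theta)=2h(\theta)$, where $f^{2\star}(x)=\int_{\mathbb{R}^d} f(x-y)f(y)\,dy$. *)

(* Defs.v *)
From HB Require Import structures.
From mathcomp Require Import all_boot all_order all_algebra.
From mathcomp Require Import all_classical all_reals all_analysis.

Set Implicit Arguments.
Unset Strict Implicit.
Unset Printing Implicit Defensive.

Import Order.TTheory GRing.Theory Num.Theory.
Import numFieldNormedType.Exports.

Local Open Scope classical_set_scope.
Local Open Scope ring_scope.

(* R^d is 'rV[R]_d.  The library has no measure on it, so Lebesgue measure is
   built as the completion of the d-fold product of lebesgue_measure on R. *)

Definition borel_rV_display : measure_display.
Proof. exact: default_measure_display. Qed.

Section borel_rV.
Context {R : realType} {n : nat}.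

Let coord (i : 'I_n) (x : 'rV[R]_n) : R := x ord0 i.

Let rV_set0 : g_sigma_preimage coord set0.
Proof. exact: sigma_algebra0. Qed.

Let rV_setC A : g_sigma_preimage coord A -> g_sigma_preimage coord (~` A).
Proof. exact: sigma_algebraC. Qed.

Let rV_bigcup (F : (set 'rV[R]_n)^nat) :
  (forall i, g_sigma_preimage coord (F i)) ->
  g_sigma_preimage coord (\bigcup_i (F i)).
Proof. exact: sigma_algebra_bigcup. Qed.

HB.instance Definition _ := @isMeasurable.Build borel_rV_display
  'rV[R]_n (g_sigma_preimage coord) rV_set0 rV_setC rV_bigcup.

Lemma measurable_coord (i : 'I_n) :
  measurable_fun [set: 'rV[R]_n] (fun x => x ord0 i).
Proof.
move=> _ Y mY; rewrite setTI; apply: sub_sigma_algebra => /=.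
rewrite -bigcup_seq/=; exists i => /=; first by rewrite mem_index_enum.
by exists Y => //; rewrite setTI.
Qed.

Lemma measurable_fun_rVP d (T : measurableType d) (f : T -> 'rV[R]_n) :
  measurable_fun [set: T] f <->
  forall i, measurable_fun [set: T] (fun x => f x ord0 i).
Proof.
split=> [mf i|mf].
  exact: (measurableT_comp (measurable_coord i) mf).
suff prefS : g_sigma_preimage (fun i => coord i \o f) `<=` measurable.
  move=> _ A mA; apply: prefS; rewrite g_sigma_preimage_comp.
  by exists A.
apply: smallest_sub; first exact: sigma_algebra_measurable.
rewrite -bigcup_seq/=; apply: bigcup_sub => i _ A [B mB <-].
exact: mf.
Qed.

End borel_rV.

Definition rV_cons {R : realType} {n : nat}
  (p : measurableTypeR R * 'rV[R]_n) : 'rV[R]_n.+1 := row_mx p.1%:M p.2.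

Section rV_cons.
Context {R : realType} {n : nat}.

Lemma rV_cons0 (p : measurableTypeR R * 'rV[R]_n) : rV_cons p ord0 ord0 = p.1.
Proof.
transitivity ((row_mx p.1%:M p.2 : 'rV[R]_(1 + n)) ord0 (lshift n ord0)).
  by rewrite /rV_cons; congr (fun_of_matrix _ _ _); exact/val_inj.
by rewrite row_mxEl mxE eqxx mulr1n.
Qed.

Lemma rV_consS (p : measurableTypeR R * 'rV[R]_n) (j : 'I_n) :
  rV_cons p ord0 (lift ord0 j) = p.2 ord0 j.
Proof.
transitivity ((row_mx p.1%:M p.2 : 'rV[R]_(1 + n)) ord0 (rshift 1 j)).
  by rewrite /rV_cons; congr (fun_of_matrix _ _ _); exact/val_inj.
by rewrite row_mxEr.
Qed.

Lemma measurable_rV_cons : measurable_fun [set: _] (@rV_cons R n).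
Proof.
apply/measurable_fun_rVP => i; case: (unliftP ord0 i) => [j|] ->.
  have -> : (fun p => rV_cons p ord0 (lift ord0 j)) =
      (fun x : 'rV[R]_n => x ord0 j) \o @snd (measurableTypeR R) _.
    by apply/funext => p; rewrite rV_consS.
  exact: measurableT_comp (measurable_coord j) measurable_snd.
have -> : (fun p => @rV_cons R n p ord0 ord0) = fst.
  by apply/funext => p; rewrite rV_cons0.
exact: measurable_fst.
Qed.

Definition rV_uncons (x : 'rV[R]_n.+1) : measurableTypeR R * 'rV[R]_n :=
  (x ord0 ord0, \row_j x ord0 (lift ord0 j)).

Lemma rV_consK : cancel (@rV_cons R n) rV_uncons.
Proof.
move=> [a v]; rewrite /rV_uncons rV_cons0 /=; congr pair.
by apply/rowP => j; rewrite mxE rV_consS.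
Qed.

Lemma measurable_rV_uncons : measurable_fun [set: _] rV_uncons.
Proof.
apply/measurable_fun_pair; first exact: measurable_coord.
apply/measurable_fun_rVP => i.
under eq_fun do rewrite mxE.
exact: measurable_coord.
Qed.

End rV_cons.

(* Lebesgue measure on the Borel sets *)
Fixpoint borel_lebesgue {R : realType} (n : nat) : set 'rV[R]_n -> \bar R :=
  if n is m.+1 then
    pushforward (@lebesgue_measure R \x @borel_lebesgue R m)%E rV_cons
  else \d_(0 : 'rV[R]_0).
Arguments borel_lebesgue R n : clear implicits.

Section borel_lebesgue_measure.
Local Open Scope ereal_scope.
Context {R : realType}.

Section step.
Context {n : nat} (m : {sigma_finite_measure set 'rV[R]_n -> \bar R}).

Let step := pushforward (@lebesgue_measure R \x m) rV_cons.

Let mpre (A : set 'rV[R]_n.+1) : measurable A -> measurable (rV_cons @^-1` A).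
Proof.
by move=> mA; rewrite -[X in measurable X]setTI; exact: measurable_rV_cons.
Qed.

Let step0 : step set0 = 0.
Proof.
by rewrite /step /pushforward preimage_set0
  (measure0 (@lebesgue_measure R \x m)).
Qed.

Let step_ge0 A : 0 <= step A.
Proof. exact: (measure_ge0 (@lebesgue_measure R \x m)). Qed.

Let step_sigma_additive : semi_sigma_additive step.
Proof.
move=> F mF tF mUF; rewrite /step /pushforward preimage_bigcup.
apply: measure_semi_sigma_additive.
- by move=> k; exact: mpre.
- apply/trivIsetP => /= i j _ _ ij; rewrite -preimage_setI.
  by move/trivIsetP : tF => /(_ _ _ _ _ ij) ->//; rewrite preimage_set0.
- by rewrite -preimage_bigcup; exact: mpre.
Qed.

HB.instance Definition _ := isMeasure.Build _ _ _ step
  step0 step_ge0 step_sigma_additive.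

Let step_sigma_finite : sigma_finite setT step.
Proof.
have /sigma_finiteP[F [TF ndF Foo]] := sigma_finiteT (@lebesgue_measure R).
have /sigma_finiteP[G [TG ndG Goo]] := sigma_finiteT m.
exists (fun k => rV_uncons @^-1` (F k `*` G k)) => [|k].
  apply/seteqP; split => // x _.
  have [i _ Fi] : (\bigcup_k F k) (rV_uncons x).1 by rewrite -TF.
  have [j _ Gj] : (\bigcup_k G k) (rV_uncons x).2 by rewrite -TG.
  exists (maxn i j) => //; split.
    by move: Fi; exact/subsetPset/ndF/leq_maxl.
  by move: Gj; exact/subsetPset/ndG/leq_maxr.
have [mF Fk] := Foo k; have [mG Gk] := Goo k; split.
  rewrite -[X in measurable X]setTI; apply: measurable_rV_uncons => //.
  exact: measurableX.
rewrite /step /pushforward -comp_preimage (_ : rV_uncons \o rV_cons = id).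
  by rewrite preimage_id product_measure1E// lte_mul_pinfty// ge0_fin_numE.
by apply/funext => p /=; rewrite rV_consK.
Qed.

HB.instance Definition _ := Measure_isSigmaFinite.Build _ _ _ step
  step_sigma_finite.

Lemma borel_lebesgue_step :
  exists m' : {sigma_finite_measure set 'rV[R]_n.+1 -> \bar R}, step = m'.
Proof. by exists step. Qed.

End step.

Let borel_lebesgue_ex n :
  exists m : {sigma_finite_measure set 'rV[R]_n -> \bar R},
    borel_lebesgue R n = m.
Proof.
elim: n => [|n [m mE]] /=; first by exists \d_(0%R : 'rV[R]_0).
by rewrite mE; exact: borel_lebesgue_step.
Qed.

Section instances.
Variable n : nat.

Let bl0 : borel_lebesgue R n set0 = 0.
Proof. by have [m ->] := borel_lebesgue_ex n; exact: measure0. Qed.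

Let bl_ge0 A : 0 <= borel_lebesgue R n A.
Proof. by have [m ->] := borel_lebesgue_ex n; exact: measure_ge0. Qed.

Let bl_sigma_additive : semi_sigma_additive (borel_lebesgue R n).
Proof.
by have [m ->] := borel_lebesgue_ex n; exact: measure_semi_sigma_additive.
Qed.

HB.instance Definition _ := isMeasure.Build _ _ _ (borel_lebesgue R n)
  bl0 bl_ge0 bl_sigma_additive.

Let bl_sigma_finite : sigma_finite setT (borel_lebesgue R n).
Proof. by have [m ->] := borel_lebesgue_ex n; exact: sigma_finiteT. Qed.

HB.instance Definition _ := Measure_isSigmaFinite.Build _ _ _
  (borel_lebesgue R n) bl_sigma_finite.

End instances.

Lemma borel_lebesgue_box n (a b : 'rV[R]_n) :
  (forall i, a ord0 i <= b ord0 i)%R ->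
  borel_lebesgue R n [set x : 'rV[R]_n | forall i, x ord0 i \in `]a ord0 i, b ord0 i] ] =
  \prod_(i < n) (b ord0 i - a ord0 i)%:E.
Proof.
elim: n a b => [|n IH] a b ab.
  rewrite big_ord0 /= diracE.
  by rewrite mem_set// => -[].
rewrite big_ord_recl.
pose a' := (rV_uncons a).2; pose b' := (rV_uncons b).2.
pose B := [set x : 'rV[R]_n | forall i, x ord0 i \in `]a' ord0 i, b' ord0 i] ].
have mB : measurable B.
  rewrite (_ : B = \bigcap_(i in [set: 'I_n])
      ((fun x : 'rV[R]_n => x ord0 i) @^-1` `]a' ord0 i, b' ord0 i]%classic)).
    apply: fin_bigcap_measurable => // i _.
    rewrite -[X in measurable X]setTI.
    apply: (measurable_coord i) => //; exact: measurable_itv.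
  by apply/seteqP; split => x /= h i => [_|]; exact: h.
transitivity ((@lebesgue_measure R \x borel_lebesgue R n)
    (`]a ord0 ord0, b ord0 ord0]%classic `*` B)).
  congr ((_ \x _) _).
  apply/seteqP; split => -[t v] /=.
    move=> h; split; first by have := h ord0; rewrite rV_cons0.
    by move=> i; have := h (lift ord0 i); rewrite rV_consS !mxE.
  move=> [h1 h2] i; case: (unliftP ord0 i) => [j|] ->; last by rewrite rV_cons0.
  by have := h2 j; rewrite rV_consS !mxE.
rewrite product_measure1E//.
congr (_ * _)%E.
  rewrite -[LHS]/(lebesgue_measure `]a ord0 ord0, b ord0 ord0]%classic).
  rewrite lebesgue_measure_itv/= lte_fin.
  have := ab ord0; rewrite le_eqVlt => /predU1P[->|->//].
  by rewrite ltxx subrr.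
rewrite -[LHS]/(borel_lebesgue R n B) IH => [|i]; last by rewrite !mxE.
by apply: eq_bigr => i _; rewrite !mxE.
Qed.

End borel_lebesgue_measure.

(* Lebesgue measure: its measurable sets are all the Lebesgue measurable sets,
   not only the Borel ones. *)
Definition lebesgue_rV (R : realType) (n : nat) : set _ -> \bar R :=
  @completed_measure_extension _ _ _ (borel_lebesgue R n).
Arguments lebesgue_rV R n : clear implicits.
HB.instance Definition _ (R : realType) (n : nat) :=
  Measure.on (lebesgue_rV R n).

Lemma lebesgue_rV_sigma_finite (R : realType) (n : nat) :
  sigma_finite setT (lebesgue_rV R n).
Proof. exact/completed_measure_extension_sigma_finite/sigma_finiteT. Qed.

HB.instance Definition _ (R : realType) (n : nat) :=
  Measure_isSigmaFinite.Build _ _ _ (lebesgue_rV R n)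
    (@lebesgue_rV_sigma_finite R n).

Lemma lebesgue_rVE (R : realType) (n : nat) (A : set 'rV[R]_n) :
  measurable A -> lebesgue_rV R n A = borel_lebesgue R n A.
Proof. exact: measurable_mu_extE. Qed.

Lemma lebesgue_rV_is_complete (R : realType) (n : nat) :
  measure_is_complete (lebesgue_rV R n).
Proof. exact: measure_is_complete_caratheodory. Qed.

Section almost_radial.
Context {R : realType} {d : nat}.
Implicit Types (x y theta : 'rV[R]_d) (f : 'rV[R]_d -> R) (gamma r : R).

Definition dot x y : R := \sum_i x ord0 i * y ord0 i.

(* the Euclidean norm; the library's `|x| on 'rV[R]_d is the max norm *)
Definition enorm x : R := Num.sqrt (dot x x).

Definition density f : Prop :=
  [/\ (lebesgue_rV R d).-integrable setT (EFin \o f),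
      forall x, 0 <= f x & f <> cst 0].

Definition almost_radial_decreasing f : Prop :=
  exists (g : R -> R) (c : R),
    [/\ forall s, 0 < s -> 0 < g s,
        forall s t, 0 < s -> s <= t -> g t <= g s,
        1 <= c &
        forall x, x != 0 ->
          c^-1 * g (enorm x) <= f x /\ f x <= c * g (enorm x)].

Definition Kf f r : \bar R :=
  ereal_sup
    [set (\int[lebesgue_rV R d]_(y in
             [set y : 'rV[R]_d | (r < enorm (x - y))%R /\ (r < enorm y)%R])
             (f (x - y) * f y / f x)%R%:E)%E
    | x in [set x : 'rV[R]_d | 1 <= enorm x]].

Definition self_conv f x : \bar R :=
  (\int[lebesgue_rV R d]_y (f (x - y) * f y)%R%:E)%E.

Definition exp_tail theta gamma f : Prop :=
  forall y, f (t *: theta - y) / f (t *: theta) @[t --> +oo]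
              --> expR (gamma * dot theta y).

Definition exp_moment theta gamma f : \bar R :=
  (\int[lebesgue_rV R d]_y (expR (gamma * dot theta y) * f y)%R%:E)%E.

(* the class S_d(theta, gamma) *)
Definition subexp_class theta gamma f : Prop :=
  [/\ (lebesgue_rV R d).-integrable setT (EFin \o f) /\ (forall x, 0 <= f x),
      exists t0, 0 < t0 /\ forall t, t0 <= t -> 0 < f (t *: theta),
      exp_tail theta gamma f,
      (exp_moment theta gamma f < +oo)%E &
      (self_conv f (t *: theta) * (f (t *: theta))^-1%:E)%E @[t --> +oo%R]
        --> (2%:E * exp_moment theta gamma f)%E].

End almost_radial.

(* Main.v *)
From HB Require Import structures.
Require Import Defs.
From mathcomp Require Import all_boot all_order all_algebra.
From mathcomp Require Import all_classical all_reals all_analysis.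
From mathcomp Require Import measurable_realfun ring lra.

(* Let I_r(x) be the integral of f(x - y) f(y) / f(x) over |x - y| > r, |y| > r,
   so that K_f(r) is the supremum of I_r(x) over |x| >= 1.  For |x| > 2r the
   substitution y -> x - y gives
     f^{2*}(x) / f(x) = 2 \int_{|y| <= r} f(x - y) f(y) / f(x) dy + I_r(x),
   and along x = t theta the integral over the ball tends, by dominated
   convergence, to the integral of e^{gamma theta.y} f(y) over the ball.  Hence
   membership in S_d(theta, gamma) means that I_r(t theta) is small when t is
   large, for r large.  All other points x are reduced to the half-line spanned
   by theta: f is comparable to a radial function and Lebesgue measure is
   invariant under reflections, so I_r(x) <= const * I_r(|x| theta); and for bounded
   |x|, I_r(x) is at most a constant times the integral of f over |y| > r. *)

Import Order.TTheory GRing.Theory Num.Theory.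
Import numFieldNormedType.Exports.

Local Open Scope classical_set_scope.
Local Open Scope ring_scope.

Set Implicit Arguments.
Unset Strict Implicit.

(** * Invariance of Lebesgue measure under rigid motions *)

Definition eball {R : realType} (n : nat) (r : R) : set 'rV[R]_n :=
  [set x | enorm x <= r].
Arguments eball {R} n r.

Section borel_lebesgue_invariance.
Context {R : realType}.

(** The image measure gives every half-open interval its length, and this property characterises
    Lebesgue measure. *)
Lemma lebesgue_measure_addr (a : R) (A : set (measurableTypeR R)) :
  measurable A ->
  pushforward lebesgue_measure (+%R^~ a : measurableTypeR R -> measurableTypeR R) A =
  lebesgue_measure A.
Proof.
have ma : measurable_fun setT (+%R^~ a : measurableTypeR R -> measurableTypeR R).
  exact: measurable_funD.
move=> mA; apply/esym.
apply: (@lebesgue_measure_unique R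
  (measure_function_pushforward__canonical__measure_function_Measure
    lebesgue_measure ma) _ _ mA) => _ [[b c]] _ <-.
rewrite -[RHS]/(lebesgue_measure (+%R^~ a @^-1` `]b, c]%classic)).
have -> : +%R^~ a @^-1` `]b, c]%classic = `]b - a, c - a]%classic.
  by apply/seteqP; split => x /=; rewrite !in_itv /= ltrBlDr lerBrDr.
rewrite !lebesgue_measure_itv /= !lte_fin ltrD2r.
by case: ifP => // _; rewrite -!EFinB; congr EFin; ring.
Qed.

Lemma measurable_addr_rV n (v : 'rV[R]_n) :
  measurable_fun [set: 'rV[R]_n] (+%R^~ v).
Proof.
apply/measurable_fun_rVP => i; under eq_fun do rewrite mxE.
by apply: measurable_funD => //; exact: measurable_coord.
Qed.

Lemma rV_consD n (p q : measurableTypeR R * 'rV[R]_n) :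
  rV_cons p + rV_cons q = rV_cons ((p.1 + q.1)%R, p.2 + q.2).
Proof.
apply/rowP => i; rewrite mxE; case: (unliftP ord0 i) => [j|] ->.
  by rewrite !rV_consS mxE.
by rewrite !rV_cons0.
Qed.

Lemma rV_unconsK n (x : 'rV[R]_n.+1) : rV_cons (rV_uncons x) = x.
Proof.
apply/rowP => i; case: (unliftP ord0 i) => [j|] ->.
  by rewrite !rV_consS mxE.
by rewrite !rV_cons0.
Qed.

Lemma borel_lebesgue_addr n (v : 'rV[R]_n) (A : set 'rV[R]_n) : measurable A ->
  borel_lebesgue R n (+%R^~ v @^-1` A) = borel_lebesgue R n A.
Proof.
elim: n v A => [|n IH] v A mA.
  by congr (borel_lebesgue R 0 _); apply/seteqP; split => x /=; rewrite !thinmx0.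
pose l := @lebesgue_measure R; pose b := borel_lebesgue R n.
have mB : measurable (rV_cons @^-1` A).
  by rewrite -[X in measurable X]setTI; exact: measurable_rV_cons.
pose phi t := b (xsection (rV_cons @^-1` A) t).
have mphi : measurable_fun [set: measurableTypeR R] phi.
  exact: measurable_fun_xsection.
pose va : measurableTypeR R := (rV_uncons v).1.
have mva : measurable_fun setT (+%R^~ va : measurableTypeR R -> measurableTypeR R).
  exact: measurable_funD.
pose sh : measurableTypeR R -> measurableTypeR R := +%R^~ va.
(* On each section the induction hypothesis absorbs the tail of [v]. Only the shift of the first
   coordinate remains, and the one-dimensional case removes it. *)
transitivity (\int[l]_t (phi \o sh) t)%E.
  apply: eq_integral => t _ /=.
  rewrite -[RHS]/(b (xsection (rV_cons @^-1` A) (sh t))).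
  rewrite -[RHS](IH (rV_uncons v).2); last exact: measurable_xsection.
  have E w : rV_cons (t, w) + v = rV_cons (sh t, w + (rV_uncons v).2).
    by rewrite -{1}(rV_unconsK v) rV_consD.
  apply: (congr1 (borel_lebesgue R n)); apply/seteqP; split => w;
    by rewrite /xsection /= !inE /preimage /= E.
have phi0 : {in [set: measurableTypeR R], forall t, (0 <= phi t)%E}.
  by move=> t _; exact: measure_ge0.
have := @ge0_integral_pushforward _ _ _ _ _ sh mva l setT phi measurableT mphi phi0.
rewrite preimage_setT => <-.
pose l' := measure_function_pushforward__canonical__measure_function_Measure l mva.
apply: (@eq_measure_integral _ _ _ _ l l') => B mB' _; exact: lebesgue_measure_addr.
Qed.

Lemma measurable_mulmxr n (M : 'M[R]_n) :
  measurable_fun [set: 'rV[R]_n] (mulmx^~ M).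
Proof.
apply/measurable_fun_rVP => i; under eq_fun do rewrite mxE.
apply: measurable_sum => j; apply: measurable_funM => //; exact: measurable_coord.
Qed.

Lemma dotE n (x y : 'rV[R]_n) : dot x y = (x *m y^T) ord0 ord0.
Proof. by rewrite mxE; apply: eq_bigr => i _; rewrite mxE. Qed.

Lemma enorm_mulmxr n (M : 'M[R]_n) (x : 'rV[R]_n) : M *m M^T = 1%:M ->
  enorm (x *m M) = enorm x.
Proof. by move=> MM; rewrite /enorm !dotE trmx_mul mulmxA -(mulmxA x) MM mulmx1. Qed.

Lemma measurable_enorm n : measurable_fun [set: 'rV[R]_n] enorm.
Proof.
have mdot : measurable_fun [set: 'rV[R]_n] (fun x => dot x x).
  by apply: measurable_sum => j; apply: measurable_funM => //; exact: measurable_coord.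
exact: measurableT_comp (continuous_measurable_fun (@sqrt_continuous R)) mdot.
Qed.

Lemma dot_ge0 n (x : 'rV[R]_n) : 0 <= dot x x.
Proof. by apply: sumr_ge0 => i _; rewrite -expr2 sqr_ge0. Qed.

Lemma enorm_ge0 n (x : 'rV[R]_n) : 0 <= enorm x.
Proof. exact: sqrtr_ge0. Qed.

Lemma sqr_enorm n (x : 'rV[R]_n) : enorm x ^+ 2 = dot x x.
Proof. by rewrite sqr_sqrtr// dot_ge0. Qed.

Lemma coord_le_enorm n (x : 'rV[R]_n) i : `|x ord0 i| <= enorm x.
Proof.
rewrite -(@ler_pXn2r _ 2%N)// ?nnegrE ?enorm_ge0// sqr_enorm real_normK ?num_real//.
rewrite /dot (bigD1 i)//= expr2 lerDl sumr_ge0// => j _.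
by rewrite -expr2 sqr_ge0.
Qed.

Lemma measurable_eball n (r : R) : measurable (eball n r).
Proof.
rewrite (_ : eball n r = enorm @^-1` `]-oo, r]%classic); last first.
  by apply/seteqP; split => x; rewrite /eball /= in_itv.
by rewrite -[X in measurable X]setTI; apply: measurable_enorm.
Qed.

Lemma measurable_box n (a b : 'rV[R]_n) :
  measurable [set x : 'rV[R]_n | forall i, x ord0 i \in `]a ord0 i, b ord0 i] ].
Proof.
rewrite (_ : [set _ | _] = \bigcap_(i in [set: 'I_n])
    ((fun x : 'rV[R]_n => x ord0 i) @^-1` `]a ord0 i, b ord0 i]%classic)).
  apply: fin_bigcap_measurable => // i _.
  rewrite -[X in measurable X]setTI.
  apply: (measurable_coord i) => //; exact: measurable_itv.
by apply/seteqP; split => x /= h i => [_|]; exact: h.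
Qed.

Lemma borel_lebesgue_eball_lty n (r : R) : (borel_lebesgue R n (eball n r) < +oo)%E.
Proof.
(* The margin 1 keeps the ball away from the excluded left ends of the box. *)
pose a : 'rV[R]_n := const_mx (- (`|r| + 1)); pose b : 'rV[R]_n := const_mx (`|r| + 1).
pose B := [set x : 'rV[R]_n | forall i, x ord0 i \in `]a ord0 i, b ord0 i] ].
have mB : measurable B by exact: measurable_box.
apply: (@le_lt_trans _ _ (borel_lebesgue R n B)).
  apply: le_measure; rewrite ?inE//; first exact: measurable_eball.
  move=> x /= xr i; rewrite in_itv /= !mxE.
  have := coord_le_enorm x i; have := ler_norm r.
  rewrite /eball /= in xr; move=> rr xi.
  have : `|x ord0 i| <= `|r| by lra.
  by rewrite ler_norml => /andP[? ?]; apply/andP; split; lra.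
rewrite /B borel_lebesgue_box.
  by rewrite prodEFin ltry.
by move=> i; rewrite !mxE; have := normr_ge0 r; lra.
Qed.

(** The ball contains the cube with sides []-1, 1]], whose points satisfy |x|^2 <= n <= n^2. In
    dimension 0 it is the whole one-point space, so radius 0 is harmless. *)
Lemma borel_lebesgue_eball_gt0 n : (0 < borel_lebesgue R n (@eball R n n%:R))%E.
Proof.
pose a : 'rV[R]_n := const_mx (-1); pose b : 'rV[R]_n := const_mx 1.
pose B := [set x : 'rV[R]_n | forall i, x ord0 i \in `]a ord0 i, b ord0 i] ].
have mB : measurable B by exact: measurable_box.
apply: (@lt_le_trans _ _ (borel_lebesgue R n B)).
  rewrite /B borel_lebesgue_box.
    by rewrite prodEFin lte_fin prodr_gt0// => i _; rewrite !mxE; lra.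
  by move=> i; rewrite !mxE; lra.
apply: le_measure; rewrite ?inE//; first exact: measurable_eball.
move=> x xB; rewrite /eball /=.
rewrite -(@ler_pXn2r _ 2%N)// ?nnegrE ?enorm_ge0// sqr_enorm.
apply: (@le_trans _ _ (\sum_(i < n) 1)).
  apply: ler_sum => i _; have := xB i; rewrite !mxE in_itv /= => /andP[? ?]; nra.
rewrite sumr_const card_ord -natrX ler_nat; case: (n) => // k.
by rewrite expnS leq_pmulr.
Qed.

(* Uniqueness of translation-invariant measures, applied to the image of the
   measure under [M]: integrate over [y] in an [M]-invariant ball and over [x]
   the indicator of [x + y M \in A], in both orders. *)
Lemma borel_lebesgue_orthogonal n (M : 'M[R]_n) (A : set 'rV[R]_n) :
  M *m M^T = 1%:M -> measurable A ->
  borel_lebesgue R n (mulmx^~ M @^-1` A) = borel_lebesgue R n A.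
Proof.
move=> MM mA; have MM' := mulmx1C MM.
pose b := borel_lebesgue R n; pose B : set 'rV[R]_n := eball n n%:R.
have mB : measurable B by exact: measurable_eball.
have preim (T : 'rV[R]_n * 'rV[R]_n -> 'rV[R]_n) D :
    measurable_fun setT T -> measurable D -> measurable (T @^-1` D).
  by move=> mT mD; rewrite -[X in measurable X]setTI; exact: mT.
have madd (T1 T2 : 'rV[R]_n * 'rV[R]_n -> 'rV[R]_n) :
    measurable_fun setT T1 -> measurable_fun setT T2 ->
    measurable_fun setT (fun p => T1 p + T2 p).
  move=> /measurable_fun_rVP m1 /measurable_fun_rVP m2.
  apply/measurable_fun_rVP => i; under eq_fun do rewrite mxE.
  exact: measurable_funD.
have mopp (T : 'rV[R]_n * 'rV[R]_n -> 'rV[R]_n) :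
    measurable_fun setT T -> measurable_fun setT (fun p => - T p).
  move=> /measurable_fun_rVP m1.
  apply/measurable_fun_rVP => i; under eq_fun do rewrite mxE.
  exact: measurableT_comp.
have msndM : measurable_fun setT (fun p : 'rV[R]_n * 'rV[R]_n => p.2 *m M).
  exact: (measurableT_comp (f := mulmx^~ M) (measurable_mulmxr M) measurable_snd).
pose G := [set p : 'rV[R]_n * 'rV[R]_n | B (p.2 *m M) /\ A (p.1 + p.2 *m M)].
pose H := [set p : 'rV[R]_n * 'rV[R]_n | B (p.2 *m M - p.1) /\ A (p.2 *m M)].
have mG : measurable G.
  by apply: (@measurableI _ _ ((fun p => p.2 *m M) @^-1` B)
    ((fun p => p.1 + p.2 *m M) @^-1` A)); apply: preim => //; exact: madd.
have mH : measurable H.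
  apply: (@measurableI _ _ ((fun p => p.2 *m M - p.1) @^-1` B)
    ((fun p => p.2 *m M) @^-1` A)); apply: preim => //.
  by apply: madd => //; exact: mopp.
have fub D : measurable D -> (\int[b]_x b (xsection D x) = \int[b]_y b (ysection D y))%E.
  move=> mD; have := indic_fubini_tonelli b b mD.
  by rewrite indic_fubini_tonelli_FE// indic_fubini_tonelli_GE.
have xE D x y : xsection D x y = D (x, y) :> Prop by rewrite /xsection /= in_setE.
have yE D x y : ysection D y x = D (x, y) :> Prop by rewrite /ysection /= in_setE.
have BM y : B (y *m M) = B y :> Prop by rewrite /B /eball /= enorm_mulmxr.
have BN z : B (- z) = B z :> Prop.
  by rewrite /B /eball /= /enorm !dotE linearN mulmxN mulNmx opprK.
(* For fixed x, replacing y by y - x M^T turns y M into y M - x, hence the section of [G] into that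
   of [H]. *)
have GH : (\int[b]_x b (xsection G x) = \int[b]_x b (xsection H x))%E.
  apply: eq_integral => x _; rewrite -[LHS](borel_lebesgue_addr (- (x *m M^T))).
    have E y : (y - x *m M^T) *m M = y *m M - x.
      by rewrite mulmxDl mulNmx -mulmxA MM' mulmx1.
    congr (b _); apply/funext => y.
    by rewrite /preimage /= !xE /G /H /= E (addrC x) subrK.
  exact: measurable_xsection.
(* For fixed y, the section of [G] is a translate of [A] if y lies in the ball and is empty
   otherwise. *)
have eG : (\int[b]_y b (ysection G y) = b A * b B)%E.
  rewrite (eq_integral (fun y => b A * (\1_B y)%:E)%E).
    rewrite ge0_integralZl//; first by rewrite integral_indic// setIT.
    by apply/measurable_EFinP; exact: measurable_indic.
  move=> y _; rewrite indicE; have [yB|yB] /= := boolP (y \in B).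
    rewrite mule1 -[RHS](borel_lebesgue_addr (y *m M))//; congr (b _).
    apply/funext => x; rewrite yE /G /= BM; rewrite in_setE in yB.
    by apply/propext; split => [[]//|].
  rewrite mule0 -[RHS](measure0 b); congr (b _); rewrite -subset0 => x.
  by rewrite yE /G /= BM => -[/mem_set]; rewrite (negbTE yB).
(* For fixed y, the section of [H] is a translate of the symmetric ball if y M lies in [A] and is
   empty otherwise. *)
have eH : (\int[b]_y b (ysection H y) = b (mulmx^~ M @^-1` A) * b B)%E.
  have mMA : measurable (mulmx^~ M @^-1` A).
    by rewrite -[X in measurable X]setTI; exact: measurable_mulmxr.
  rewrite muleC (eq_integral (fun y => b B * (\1_(mulmx^~ M @^-1` A) y)%:E)%E).
    rewrite ge0_integralZl//; first by rewrite integral_indic// setIT.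
    by apply/measurable_EFinP; exact: measurable_indic.
  move=> y _; rewrite indicE; have [yA|yA] /= := boolP (y \in _).
    rewrite mule1 -[RHS](borel_lebesgue_addr (- (y *m M)))//; congr (b _).
    apply/funext => x; rewrite yE /H /= -BN opprB; rewrite in_setE in yA.
    by apply/propext; split => [[]//|].
  rewrite mule0 -[RHS](measure0 b); congr (b _); rewrite -subset0 => x.
  rewrite yE /H /= => -[_ yA']; move/negP: yA; apply; exact: mem_set.
have B0 := borel_lebesgue_eball_gt0 n; have Boo := borel_lebesgue_eball_lty n n%:R.
have : (b (mulmx^~ M @^-1` A) * b B = b A * b B)%E by rewrite -eH -eG -!fub.
have Bfin : b B \is a fin_num by rewrite ge0_fin_numE.
rewrite -(fineK Bfin) => /(congr1 (fun z => z * (fine (b B))^-1%:E)%E).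
rewrite -!muleA -EFinM mulfV ?mule1//.
by rewrite gt_eqF// fine_gt0// B0 Boo.
Qed.

End borel_lebesgue_invariance.

(** * Transfer of invariance to the outer measure and the completion *)

Section completion_invariance.
Context d (T : measurableType d) (R : realType).
Variables (mu : {measure set T -> \bar R}).

(** Pulling back a countable measurable cover of [A] gives a cover of the preimage with the same
    total mass. *)
Lemma le_mu_ext_preimage (f : T -> T) (A : set T) :
  measurable_fun setT f ->
  (forall B, measurable B -> mu (f @^-1` B) = mu B) ->
  (mu_ext mu (f @^-1` A) <= mu_ext mu A)%E.
Proof.
move=> mf fmu; apply: le_ereal_inf_tmp => _ [B [mB AB] <-].
apply: ereal_inf_lbound; exists (fun k => f @^-1` B k).
  split=> [k|x /AB[k _ Bk]]; last by exists k.
  by rewrite -[X in measurable X]setTI; exact: mf.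
by apply: eq_eseriesr => k _; exact: fmu.
Qed.

Variables f g : T -> T.
Hypotheses (fK : cancel f g) (gK : cancel g f).
Hypotheses (mf : measurable_fun setT f) (mg : measurable_fun setT g).
Hypothesis fmu : forall B, measurable B -> mu (f @^-1` B) = mu B.

(** The reverse inequality is the previous lemma for the inverse [g], which preserves [mu] because
    [f] does. *)
Lemma mu_ext_preimage A : mu_ext mu (f @^-1` A) = mu_ext mu A.
Proof.
apply/eqP; rewrite eq_le le_mu_ext_preimage//=.
have -> : mu_ext mu A = mu_ext mu (g @^-1` (f @^-1` A)).
  by congr (mu_ext mu _); apply/funext => x; rewrite /preimage /= gK.
apply: le_mu_ext_preimage => // B mB.
rewrite -(fmu (B := g @^-1` B)).
  by congr (mu _); apply/funext => x; rewrite /preimage /= fK.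
by rewrite -[X in measurable X]setTI; exact: mg.
Qed.

(** Splitting [X] by the preimage of [A] under [f] amounts to splitting the preimage of [X] under
    [g] by [A], since [f] preserves the outer measure. *)
Lemma caratheodory_measurable_preimage A :
  caratheodory_measurable (mu_ext mu) A ->
  caratheodory_measurable (mu_ext mu) (f @^-1` A).
Proof.
move=> mA X.
have EX Y : mu_ext mu (X `&` f @^-1` Y) = mu_ext mu (g @^-1` X `&` Y).
  rewrite -[RHS]mu_ext_preimage; congr (mu_ext mu _).
  by apply/funext => x; rewrite /preimage /= /setI /= fK.
have := mA (g @^-1` X); rewrite -!EX -preimage_setC => <-.
by have := EX setT; rewrite preimage_setT !setIT.
Qed.

End completion_invariance.

(* ['rV[R]_n] with its Lebesgue measurable sets; ['rV[R]_n] itself carries the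
   Borel ones. *)
Notation lrV R n := (caratheodory_type (mu_ext (borel_lebesgue R n))).

Section lebesgue_rV_invariance.
Context {R : realType} {n : nat}.
Implicit Types (x y : 'rV[R]_n) (M : 'M[R]_n).

Lemma lebesgue_measurable_set (A : set 'rV[R]_n) : measurable A ->
  measurable (A : set (lrV R n)).
Proof. exact: caratheodory_measurable_mu_ext. Qed.

Lemma lebesgue_measurable_eball (r : R) : measurable (eball n r : set (lrV R n)).
Proof. by apply: lebesgue_measurable_set; exact: measurable_eball. Qed.

Lemma lebesgue_measurable_fun d (U : measurableType d) (h : 'rV[R]_n -> U) :
  measurable_fun setT h -> measurable_fun setT (h : lrV R n -> U).
Proof. by move=> mh _ Y mY; apply: lebesgue_measurable_set; exact: mh. Qed.

(** One family covers both substitutions needed later: y -> x - y, with M = -1, and orthogonal maps,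
    with x = 0. *)
Local Definition rigid x M y := x + y *m M.

Let rigidK x M : M *m M^T = 1%:M ->
  cancel (rigid x M) (rigid (- (x *m M^T)) M^T).
Proof.
by move=> MM y; rewrite /rigid mulmxDl -mulmxA MM mulmx1 addKr.
Qed.

Let measurable_rigid x M : measurable_fun setT (rigid x M).
Proof.
rewrite /rigid; under eq_fun do rewrite addrC.
exact: measurableT_comp (measurable_addr_rV x) (measurable_mulmxr M).
Qed.

Let borel_lebesgue_rigid x M A : M *m M^T = 1%:M -> measurable A ->
  borel_lebesgue R n (rigid x M @^-1` A) = borel_lebesgue R n A.
Proof.
move=> MM mA; rewrite -[RHS](borel_lebesgue_addr x)//.
have mAx : measurable (+%R^~ x @^-1` A).
  by rewrite -[X in measurable X]setTI; exact: measurable_addr_rV.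
rewrite -[RHS](borel_lebesgue_orthogonal MM)//.
by congr (borel_lebesgue R n _); apply/funext => y; rewrite /preimage /= /rigid addrC.
Qed.

Let rigidK' x M : M *m M^T = 1%:M ->
  cancel (rigid (- (x *m M^T)) M^T) (rigid x M).
Proof.
move=> MM y; have MM' := mulmx1C MM.
by rewrite /rigid mulmxDl mulNmx -!mulmxA MM' !mulmx1 addNKr.
Qed.

Lemma lebesgue_measurable_rigid x M : M *m M^T = 1%:M ->
  measurable_fun setT ((fun y => x + y *m M) : lrV R n -> lrV R n).
Proof.
move=> MM _ Y mY; rewrite setTI.
apply: (caratheodory_measurable_preimage (rigidK x MM) (rigidK' x MM)) => //.
by move=> B mB; exact: borel_lebesgue_rigid.
Qed.

Lemma ge0_integral_rigid x M (D : set (lrV R n)) (k : lrV R n -> \bar R) :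
  M *m M^T = 1%:M -> measurable D -> measurable_fun D k ->
  (forall y, D y -> (0 <= k y)%E) ->
  (\int[lebesgue_rV R n]_(y in D) k y =
   \int[lebesgue_rV R n]_(y in (fun y => (x + y *m M)%R) @^-1` D) k (x + y *m M)%R)%E.
Proof.
move=> MM mD mk k0; have mr := lebesgue_measurable_rigid x MM.
have k0' : {in D, forall y, (0 <= k y)%E} by move=> y; rewrite inE => /k0.
rewrite -[RHS](ge0_integral_pushforward mr (lebesgue_rV R n) mD mk k0').
pose l' := measure_function_pushforward__canonical__measure_function_Measure
  (lebesgue_rV R n) mr.
apply: (@eq_measure_integral _ _ _ _ l' (lebesgue_rV R n)) => B mB _.
apply/esym; apply: (mu_ext_preimage (rigidK x MM) (rigidK' x MM)).
- exact: measurable_rigid.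
- exact: measurable_rigid.
- by move=> B' mB'; exact: borel_lebesgue_rigid.
Qed.

End lebesgue_rV_invariance.

(** * Euclidean norm and integrals over balls *)

Section euclidean_norm.
Context {R : realType} {n : nat}.
Implicit Types (x y z : 'rV[R]_n) (a : R).

Lemma dotC x y : dot x y = dot y x.
Proof. by apply: eq_bigr => i _; rewrite mulrC. Qed.

Lemma dotDl x y z : dot (x + y) z = dot x z + dot y z.
Proof. by rewrite !dotE mulmxDl mxE. Qed.

Lemma dotZl a x z : dot (a *: x) z = a * dot x z.
Proof. by rewrite !dotE -scalemxAl mxE. Qed.

Lemma dotNl x z : dot (- x) z = - dot x z.
Proof. by rewrite -scaleN1r dotZl mulN1r. Qed.

Lemma enorm0_eq0 x : enorm x = 0 -> x = 0.
Proof.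
move=> x0; apply/rowP => i; rewrite mxE; apply/eqP.
by rewrite -normr_le0 -x0 coord_le_enorm.
Qed.

Lemma enorm_gt0_neq0 x : 0 < enorm x -> x != 0.
Proof.
apply: contraTneq => ->; rewrite /enorm -(scale0r (0 : 'rV[R]_n)) dotZl mul0r.
by rewrite sqrtr0 ltxx.
Qed.

Lemma enormZ a x : enorm (a *: x) = `|a| * enorm x.
Proof.
rewrite /enorm dotZl dotC dotZl mulrA -expr2 sqrtrM ?sqr_ge0//.
by rewrite sqrtr_sqr.
Qed.

(** Cauchy-Schwarz, from the nonnegative squared norm of (y.y) x - (x.y) y. After division by y.y
    this leaves (x.y)^2 <= (x.x)(y.y). *)
Lemma dot_le_enorm x y : dot x y <= enorm x * enorm y.
Proof.
have [y0|y0] := eqVneq (enorm y) 0.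
  by rewrite y0 mulr0 (enorm0_eq0 y0) dotC -(scale0r (0 : 'rV[R]_n)) dotZl mul0r.
have yy : 0 < dot y y by rewrite -sqr_enorm exprn_gt0// lt0r y0 enorm_ge0.
have := dot_ge0 (dot y y *: x + - (dot x y *: y)).
rewrite !(dotDl, dotNl, dotZl) !(dotC x) !(dotC y) !(dotDl, dotNl, dotZl) (dotC y x).
rewrite (_ : _ + _ = dot y y * (dot x x * dot y y - dot x y ^+ 2)); last by ring.
rewrite pmulr_rge0// subr_ge0 => h.
apply: (le_trans (ler_norm _)).
rewrite -(@ler_pXn2r _ 2%N)// ?nnegrE ?mulr_ge0 ?enorm_ge0//.
by rewrite real_normK ?num_real// exprMn !sqr_enorm.
Qed.

Lemma ler_enormD x y : enorm (x + y) <= enorm x + enorm y.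
Proof.
rewrite -(@ler_pXn2r _ 2%N)// ?nnegrE ?addr_ge0 ?enorm_ge0//.
rewrite sqrrD !sqr_enorm dotDl !(dotC _ (x + y)) !dotDl (dotC y x).
by have := dot_le_enorm x y; rewrite mulr2n; lra.
Qed.

Lemma ler_enormB x y : enorm x - enorm y <= enorm (x - y).
Proof. by rewrite lerBlDr; apply: le_trans (ler_enormD _ _); rewrite subrK. Qed.

(* The Householder reflection in the hyperplane orthogonal to [x - z];
   when [x = z] the factor [(dot 0 0)^-1 = 0] makes it the identity. *)
Lemma exists_orthogonal x z : enorm x = enorm z ->
  exists M : 'M[R]_n, M *m M^T = 1%:M /\ x *m M = z.
Proof.
move=> xz; pose u := x - z; pose k := 2 / dot u u.
exists (1%:M - k *: (u^T *m u)).
have [u0|u0] := eqVneq u 0.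
  rewrite u0 mulmx0 scaler0 subr0 trmx1 !mulmx1; split => //.
  by apply/eqP; rewrite -subr_eq0 -/u u0.
have uu : dot u u != 0.
  by rewrite -sqr_enorm sqrf_eq0; apply: contra_neq u0; exact: enorm0_eq0.
have dotM v w : v *m w^T = (dot v w)%:M :> 'M[R]_1.
  by rewrite [LHS]mx11_scalar dotE.
have uuE : dot u u = 2 * dot x u.
  have := congr1 (fun s => s ^+ 2) xz; rewrite !sqr_enorm => xxzz.
  rewrite /u !(dotDl, dotNl) !(dotC _ (x - z)) !(dotDl, dotNl) (dotC z x) -xxzz.
  by ring.
split; last first.
  rewrite mulmxBr mulmx1 -scalemxAr mulmxA dotM mul_scalar_mx scalerA.
  rewrite (_ : k * _ = 1) ?scale1r ?subKr// /k mulrAC -uuE.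
  by rewrite divff.
have : (u^T *m u)^T = u^T *m u by rewrite trmx_mul trmxK.
have : (u^T *m u) *m (u^T *m u) = dot u u *: (u^T *m u).
  by rewrite -mulmxA (mulmxA u) dotM mul_scalar_mx -scalemxAr.
move: (u^T *m u) => P PP PT.
have -> : (1%:M - k *: P)^T = 1%:M - k *: P.
  by apply/matrixP => i j; rewrite -[in RHS]PT !mxE eq_sym.
rewrite mulmxBl mul1mx mulmxBr mulmx1 -scalemxAl -scalemxAr PP !scalerA.
rewrite (_ : k * _ * _ = k + k); last by rewrite /k; field.
by rewrite scalerDl opprB addrK subrK.
Qed.

End euclidean_norm.

Section exhaustion.
Context {R : realType} {n : nat}.
Local Open Scope ereal_scope.
Variable k : lrV R n -> \bar R.
Hypotheses (mk : measurable_fun setT k) (k0 : forall y, 0 <= k y).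

Lemma integral_eballC (r : R) : \int[lebesgue_rV R n]_y k y =
  \int[lebesgue_rV R n]_(y in eball n r) k y +
  \int[lebesgue_rV R n]_(y in ~` eball n r) k y.
Proof.
rewrite -ge0_integral_setU//.
- by rewrite setUv.
- exact: lebesgue_measurable_eball.
- exact/measurableC/lebesgue_measurable_eball.
- exact: measurable_funTS.
- by apply/disj_setPCl.
Qed.

Lemma cvg_integral_eball :
  \int[lebesgue_rV R n]_(y in eball n i%:R) k y @[i --> \oo] -->
  \int[lebesgue_rV R n]_y k y.
Proof.
have -> : [set: lrV R n] = \bigcup_i eball n i%:R.
  apply/seteqP; split => // x _; exists (Num.truncn (enorm (x : 'rV[R]_n))).+1 => //.
  exact/ltW/truncnS_gt.
apply: ge0_nondecreasing_set_cvg_integral => //.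
- move=> i j ij; apply/subsetPset => x /le_trans; apply.
  by rewrite ler_nat.
- by move=> i; exact: lebesgue_measurable_eball.
- by move=> i; exact: measurable_funTS.
Qed.

Lemma integral_eballC_small (e : R) : (0 < e)%R ->
  \int[lebesgue_rV R n]_y k y < +oo ->
  exists i : nat, \int[lebesgue_rV R n]_(y in ~` eball n i%:R) k y <= e%:E.
Proof.
move=> e0 koo.
have kfin : \int[lebesgue_rV R n]_y k y \is a fin_num.
  by rewrite ge0_fin_numE// integral_ge0.
have := cvg_integral_eball; rewrite -(fineK kfin) => /fine_cvgP[fi] /cvgrPdist_le /(_ _ e0) ci.
near \oo => i; exists i.
have fini : \int[lebesgue_rV R n]_(y in eball n i%:R) k y \is a fin_num by near: i.
have := integral_eballC i%:R; rewrite -(fineK kfin) -(fineK fini).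
have : (`|fine (\int[lebesgue_rV R n]_y k y) -
  fine (\int[lebesgue_rV R n]_(y in eball n i%:R) k y)| <= e)%R by near: i.
case: (\int[_]_(y in ~` _) _) => [a| |].
- by rewrite -EFinD => /[swap] -[->]; rewrite addrAC subrr add0r lee_fin => /(le_trans (ler_norm _)).
- by [].
- by rewrite leNye.
Unshelve. all: by end_near. Qed.

End exhaustion.

(** * The convolution ratio f(x - y) f(y) / f(x) *)

Section convolution_ratio.
Context {R : realType} {d : nat}.
Implicit Types (x y z theta : 'rV[R]_d) (r t e : R).
Variables (f : 'rV[R]_d -> R) (C : R).
Local Notation leb := (lebesgue_rV R d).

Definition conv_ratio x y : R := f (x - y) * f y / f x.

Definition far r x : set 'rV[R]_d := [set y | r < enorm (x - y) /\ r < enorm y].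

Hypothesis f_int : leb.-integrable setT (EFin \o f).
Hypothesis f_ge0 : forall x, 0 <= f x.
Hypothesis f_gt0 : forall x, x != 0 -> 0 < f x.
Hypothesis C_ge1 : 1 <= C.
(* The only form in which radial monotonicity is used, with [C] the square of
   the constant in [almost_radial_decreasing]. *)
Hypothesis f_le : forall x y, y != 0 -> enorm y <= enorm x -> f x <= C * f y.

Let C_gt0 : 0 < C. Proof. exact: lt_le_trans C_ge1. Qed.

Lemma conv_ratio_ge0 x y : 0 <= conv_ratio x y.
Proof. by rewrite /conv_ratio divr_ge0// mulr_ge0. Qed.

Lemma orthogonalN1 : (- 1%:M) *m (- 1%:M)^T = 1%:M :> 'M[R]_d.
Proof. by rewrite linearN /= trmx1 mulNmx mulmxN opprK mulmx1. Qed.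

Let subE x y : x + y *m (- 1%:M) = x - y.
Proof. by rewrite mulmxN mulmx1. Qed.

Lemma lebesgue_measurable_subl x :
  measurable_fun setT ((fun y => x - y) : lrV R d -> lrV R d).
Proof.
have := lebesgue_measurable_rigid x orthogonalN1.
by under eq_fun do rewrite subE.
Qed.

Lemma measurable_density : measurable_fun setT (f : lrV R d -> R).
Proof. by apply/measurable_EFinP; exact: measurable_int f_int. Qed.

Lemma measurable_conv_ratio x : measurable_fun setT (conv_ratio x : lrV R d -> R).
Proof.
apply: measurable_funM; last exact: measurable_cst.
apply: measurable_funM; last exact: measurable_density.
exact: measurableT_comp measurable_density (lebesgue_measurable_subl x).
Qed.

Lemma not_eballE r x : (~` eball d r) x = (r < enorm x) :> Prop.
Proof. by apply/propext; rewrite /setC /eball /= ltNge; split => /negP. Qed.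

Lemma measurable_far r x : measurable (far r x : set (lrV R d)).
Proof.
have mC : measurable (~` eball d r : set (lrV R d)).
  by apply: measurableC; exact: lebesgue_measurable_eball.
rewrite (_ : far r x = (fun y => x - y) @^-1` (~` eball d r) `&` ~` eball d r).
  apply: measurableI => //; rewrite -[X in measurable X]setTI.
  exact: lebesgue_measurable_subl.
by apply/funext => y;
  rewrite -[RHS]/((~` eball d r) (x - y) /\ (~` eball d r) y) !not_eballE.
Qed.

Local Open Scope ereal_scope.

(** This is the I_r(x) of the introduction. *)
Definition far_integral r x : \bar R :=
  \int[leb]_(y in far r x) (conv_ratio x y)%:E.

Lemma far_integral_ge0 r x : 0 <= far_integral r x.
Proof. by apply: integral_ge0 => y _; rewrite lee_fin conv_ratio_ge0. Qed.

Let measurable_ratio x D :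
  measurable_fun D ((fun y => (conv_ratio x y)%:E) : lrV R d -> _).
Proof.
by apply: measurable_funTS; apply/measurable_EFinP; exact: measurable_conv_ratio.
Qed.

Lemma le_far_integral r1 r2 x : (r1 <= r2)%R -> far_integral r2 x <= far_integral r1 x.
Proof.
move=> r12; apply: ge0_subset_integral.
- exact: measurable_far.
- exact: measurable_far.
- exact: measurable_ratio.
- by move=> y _; rewrite lee_fin conv_ratio_ge0.
- by move=> y [? ?]; split; exact: le_lt_trans r12 _.
Qed.

Lemma integral_conv_ratio r x : (2 * r < enorm x)%R ->
  \int[leb]_y (conv_ratio x y)%:E =
  2%:E * \int[leb]_(y in eball d r) (conv_ratio x y)%:E + far_integral r x.
Proof.
move=> rx; pose B : set (lrV R d) := eball d r.
pose B' : set (lrV R d) := (fun y => (x - y)%R) @^-1` B.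
have mB : measurable B by exact: lebesgue_measurable_eball.
have mB' : measurable B'.
  by rewrite -[X in measurable X]setTI; exact: lebesgue_measurable_subl.
(* The reflection y -> x - y exchanges the two balls and leaves [conv_ratio x] unchanged. *)
have eB' : \int[leb]_(y in B') (conv_ratio x y)%:E = \int[leb]_(y in B) (conv_ratio x y)%:E.
  rewrite [RHS](ge0_integral_rigid x orthogonalN1) //; last first.
    by move=> y _; rewrite lee_fin conv_ratio_ge0.
  rewrite /B'; under [in RHS]eq_fun do rewrite subE.
  apply: eq_integral => y _; congr EFin.
  by rewrite subE /conv_ratio subKr (mulrC (f y)).
have far0 : far r x = ~` (B `|` B').
  rewrite setCU setIC; apply/funext => y.
  by rewrite -[RHS]/((~` eball d r) (x - y)%R /\ (~` eball d r) y) !not_eballE.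
rewrite /far_integral far0 -[X in \int[leb]_(y in X) _ = _](setUv (B `|` B')).
have mBB : measurable (B `|` B') by exact: measurableU.
have ge0 y : 0 <= (conv_ratio x y)%:E by rewrite lee_fin conv_ratio_ge0.
rewrite ge0_integral_setU//; [|exact: measurableC|exact/disj_setPCl].
(* The balls are disjoint: a common point would give |x| <= 2r. *)
congr (_ + _); rewrite ge0_integral_setU//; last first.
  rewrite disj_set2E; apply/eqP; rewrite -subset0 => y [].
  rewrite /B' /B /eball /preimage /= => y1 y2.
  have := ler_enormD (x - y) y; rewrite subrK => h.
  by move: rx; rewrite ltNge => /negP; apply; lra.
rewrite eB' (_ : 2%:E = 1 + 1)%E; last by rewrite -EFinD.
by rewrite ge0_muleDl ?mul1e ?lee_fin.
Qed.

(** An orthogonal map taking x to z carries one region to the other. Each of the three values of [f]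
    in the ratio is compared with its value at a point of equal norm, at the cost of a factor [C].
    Since r >= 0, the points x - y and y are nonzero on the region, as these comparisons require. *)
Lemma far_integral_rotate r x z : (0 <= r)%R -> (0 < enorm x)%R -> enorm x = enorm z ->
  far_integral r x <= (C ^+ 3)%:E * far_integral r z.
Proof.
move=> r0 x0 xz; have [M [MM xM]] := exists_orthogonal xz.
have ge0 v y : 0 <= (conv_ratio v y)%:E by rewrite lee_fin conv_ratio_ge0.
have EM (v : 'rV[R]_d) : enorm (v *m M) = enorm v by exact: enorm_mulmxr.
rewrite /far_integral [X in _ <= _ * X](ge0_integral_rigid 0%R MM) //; last first.
  exact: measurable_far.
have -> : (fun y => (0 + y *m M)%R) @^-1` far r z = far r x.
  apply/funext => y; rewrite /far /preimage /= add0r EM -xM.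
  by rewrite -mulmxBl EM.
have mM : measurable_fun setT ((fun y => (conv_ratio z (0 + y *m M))%:E) : lrV R d -> \bar R).
  exact: (measurableT_comp (f := (fun y => (conv_ratio z y)%:E) : lrV R d -> \bar R)
    (@measurable_ratio z setT) (lebesgue_measurable_rigid 0%R MM)).
have C3 : 0 <= (C ^+ 3)%:E by rewrite lee_fin exprn_ge0// ltW.
rewrite -(ge0_integralZl leb (measurable_far r x) (measurable_funTS mM) _ C3); last first.
  by move=> y _; exact: ge0.
apply: ge0_le_integral.
- exact: measurable_far.
- by move=> y _; exact: ge0.
- exact: measurable_ratio.
- by apply: measurable_funeM; exact: measurable_funTS.
move=> y [xy ry]; rewrite -EFinM lee_fin add0r /conv_ratio.
have z0 : (0 < enorm z)%R by rewrite -xz.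
have h1 : (f (x - y) <= C * f (z - y *m M))%R.
  rewrite -xM -mulmxBl; apply: f_le; last by rewrite EM.
  by apply: enorm_gt0_neq0; rewrite EM; exact: le_lt_trans xy.
have h2 : (f y <= C * f (y *m M))%R.
  apply: f_le; last by rewrite EM.
  by apply: enorm_gt0_neq0; rewrite EM; exact: le_lt_trans ry.
have h3 : (f z <= C * f x)%R by apply: f_le; [exact: enorm_gt0_neq0|rewrite xz].
have fx := f_gt0 (enorm_gt0_neq0 x0); have fz := f_gt0 (enorm_gt0_neq0 z0).
rewrite ler_pdivrMr// (_ : C ^+ 3 * _ * f x =
  (C * f (z - y *m M)) * (C * f (y *m M)) * (C * f x / f z))%R; last first.
  by field; exact: lt0r_neq0.
apply: (@le_trans _ _ (C * f (z - y *m M) * (C * f (y *m M)))%R).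
  by apply: ler_pM.
rewrite ler_peMr// ?mulr_ge0 ?f_ge0// ?(ltW C_gt0)//.
by rewrite ler_pdivlMr// mul1r.
Qed.

Lemma far_integral_bounded theta t e : enorm theta = 1%R -> (1 <= t)%R -> (0 < e)%R ->
  exists r0, forall r x, (r0 <= r)%R -> (1 <= enorm x <= t)%R ->
    far_integral r x <= e%:E.
Proof.
move=> th1 t1 e0.
have th0 : theta != 0%R by apply: enorm_gt0_neq0; rewrite th1.
have tth : enorm (t *: theta) = t by rewrite enormZ th1 mulr1 ger0_norm//; lra.
have tth0 : t *: theta != 0%R by apply: enorm_gt0_neq0; rewrite tth; lra.
(* One factor [C] comes from f(x - y) <= C f(theta), valid once |x - y| > 1, and the other from f(t
   theta) <= C f(x), valid for |x| <= t. Thus the ratio is at most K f(y). *)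
pose K := (C ^+ 2 * f theta / f (t *: theta))%R.
have fth := f_gt0 th0; have fth' := f_gt0 tth0.
have K0 : (0 < K)%R by rewrite divr_gt0// mulr_gt0// exprn_gt0.
have foo : \int[leb]_y (f y)%:E < +oo.
  have /integrableP[_] := f_int; congr (_ < _); apply: eq_integral => y _.
  by rewrite /= ger0_norm.
have mf : measurable_fun setT ((EFin \o f) : lrV R d -> \bar R) by exact: measurable_int f_int.
have f0 y : 0 <= (EFin \o f) y by rewrite lee_fin.
have [i iK] := integral_eballC_small mf f0 (divr_gt0 e0 K0) foo.
(* This choice ensures both r >= i, for the tail of the integral of [f], and r >= 1, for the bound
   on f(x - y). *)
exists (i%:R + 1)%R => r x ir /andP[x1 xt].
have r1 : (1 <= r)%R by have := ler0n R i; lra.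
apply: (@le_trans _ _ (\int[leb]_(y in ~` eball d i%:R) (K%:E * (f y)%:E))).
  apply: (@le_trans _ _ (\int[leb]_(y in far r x) (K%:E * (f y)%:E))).
    apply: ge0_le_integral.
    - exact: measurable_far.
    - by move=> y _; rewrite lee_fin conv_ratio_ge0.
    - exact: measurable_ratio.
    - by apply: measurable_funeM; exact: measurable_funTS.
    move=> y [xy ry]; rewrite -EFinM lee_fin /conv_ratio.
    have h1 : (f (x - y) <= C * f theta)%R by apply: f_le => //; rewrite th1; lra.
    have x0 : x != 0%R by apply: enorm_gt0_neq0; lra.
    have h2 : (f (t *: theta) <= C * f x)%R by apply: f_le => //; rewrite tth.
    have fx := f_gt0 x0.
    rewrite ler_pdivrMr// (_ : K * f y * f x =
      (C * f theta) * f y * (C * f x / f (t *: theta)))%R; last first.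
      by rewrite /K; field; exact: lt0r_neq0.
    apply: (@le_trans _ _ (C * f theta * f y)%R); first by rewrite ler_wpM2r.
    rewrite ler_peMr// ?mulr_ge0 ?f_ge0// ?(ltW C_gt0)//.
    by rewrite ler_pdivlMr// mul1r.
  apply: ge0_subset_integral.
  - exact: measurable_far.
  - by apply: measurableC; exact: lebesgue_measurable_eball.
  - by apply: measurable_funeM; exact: measurable_funTS.
  - by move=> y _; rewrite -EFinM lee_fin mulr_ge0// ltW.
  - by move=> y [_ ry]; rewrite not_eballE; lra.
have mC : measurable (~` eball d i%:R : set (lrV R d)).
  by apply: measurableC; exact: lebesgue_measurable_eball.
rewrite (ge0_integralZl leb mC (measurable_funTS mf)) ?lee_fin ?(ltW K0)//.
by rewrite -lee_pdivlMl// muleC -EFinM; exact: iK.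
Qed.

(** * Convergence of the ratio integral over a fixed ball *)

Definition exp_weight gamma theta y : R := (expR (gamma * dot theta y) * f y)%R.

Lemma exp_weight_ge0 gamma theta y : (0 <= exp_weight gamma theta y)%R.
Proof. by rewrite mulr_ge0// expR_ge0. Qed.

Lemma measurable_exp_weight gamma theta :
  measurable_fun setT (exp_weight gamma theta : lrV R d -> R).
Proof.
apply: measurable_funM; last exact: measurable_density.
apply: lebesgue_measurable_fun.
apply: (measurableT_comp (@measurable_expR R)).
apply: measurable_funM; first exact: measurable_cst.
apply: measurable_sum => i; apply: measurable_funM; first exact: measurable_cst.
exact: measurable_coord.
Qed.

Let exp_int D theta gamma : \bar R := \int[leb]_(y in D) (exp_weight gamma theta y)%:E.

(** The majorant for dominated convergence. For |y| <= r < t one has |t theta - y| >= t - r, so f(t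
    theta - y) <= C f((t - r) theta). The tail limit at the single point r theta then bounds the
    ratio uniformly in y. *)
Lemma exp_tail_bound theta gamma r : enorm theta = 1%R -> (0 <= r)%R ->
  exp_tail theta gamma f ->
  exists T K, [/\ (r < T)%R, (0 <= K)%R & forall t y, (T < t)%R -> (enorm y <= r)%R ->
    (conv_ratio (t *: theta) y <= K * f y)%R].
Proof.
move=> th1 r0 /(_ (r *: theta)); set l := expR _ => /cvgr_le /(_ (l + 1)%R).
have ll : (l < l + 1)%R by rewrite ltrDl.
move=> /(_ ll) [T0 [_ HT]].
exists (Num.max T0 r + 1)%R, (C * (l + 1))%R; split.
- by rewrite (@le_lt_trans _ _ (Num.max T0 r)) ?le_max ?lexx ?orbT// ltrDl.
- by rewrite mulr_ge0 ?(ltW C_gt0)// addr_ge0// expR_ge0.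
move=> t y Tt yr.
have [T0t rt] : (T0 < t)%R /\ (r < t)%R.
  have : (Num.max T0 r < t)%R by apply: lt_trans Tt; rewrite ltrDl.
  by rewrite gt_max => /andP.
have enT s : enorm (s *: theta) = `|s|%R by rewrite enormZ th1 mulr1.
have t0 : (0 < t)%R by exact: le_lt_trans rt.
have x0 : t *: theta != 0%R by apply: enorm_gt0_neq0; rewrite enT gtr0_norm.
have fx := f_gt0 x0.
rewrite /conv_ratio mulrAC ler_wpM2r//.
have h1 : (f (t *: theta - y) <= C * f (t *: theta - r *: theta))%R.
  have tr : (0 < t - r)%R by rewrite subr_gt0.
  have e : enorm (t *: theta - r *: theta) = (t - r)%R.
    by rewrite -scalerBl enT gtr0_norm.
  apply: f_le; first by apply: enorm_gt0_neq0; rewrite e.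
  rewrite e; apply: le_trans (ler_enormB _ _).
  by rewrite enT gtr0_norm// lerB.
have h2 := HT _ T0t.
rewrite ler_pdivrMr//; apply: (le_trans h1).
rewrite -mulrA ler_wpM2l ?(ltW C_gt0)//.
by rewrite -ler_pdivrMr.
Qed.

Lemma cvgn_integral_eball_ratio theta gamma r (u : R^nat) :
  enorm theta = 1%R -> (0 <= r)%R -> exp_tail theta gamma f -> u n @[n --> \oo] --> +oo%R ->
  exp_int (eball d r) theta gamma < +oo /\
  \int[leb]_(y in eball d r) (conv_ratio (u n *: theta) y)%:E @[n --> \oo] -->
    exp_int (eball d r) theta gamma.
Proof.
move=> th1 r0 ft uoo; have [T [K [rT K0 HK]]] := exp_tail_bound th1 r0 ft.
have [N _ HN] : \forall n \near \oo, (T < u n)%R by move/cvgryPgt : uoo; exact.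
pose B : set (lrV R d) := eball d r.
have mB : measurable B by exact: lebesgue_measurable_eball.
(* The majorant is available only past [T], so the first [N] terms are dropped. *)
pose v n := u (n + N)%N.
have voo : v n @[n --> \oo] --> +oo%R by rewrite /v (cvg_shiftn N u).
have Tv n : (T < v n)%R by apply: HN; rewrite /= leq_addl.
have mF n : measurable_fun B ((fun y => (conv_ratio (v n *: theta) y)%:E) : lrV R d -> \bar R).
  exact: measurable_ratio.
have mG : measurable_fun B ((fun y => (exp_weight gamma theta y)%:E) : lrV R d -> \bar R).
  by apply: measurable_funTS; apply/measurable_EFinP; exact: measurable_exp_weight.
have cF y : (conv_ratio (v n *: theta) y)%:E @[n --> \oo] --> (exp_weight gamma theta y)%:E.
  apply/fine_cvgP; split; first exact: nearW.
  have /cvg_pinftyP /(_ v voo) h := ft y.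
  rewrite /comp /exp_weight /=.
  under eq_fun do rewrite /conv_ratio mulrAC.
  exact: cvgM h (cvg_cst _).
have iK : leb.-integrable B (fun y => K%:E * (f y)%:E).
  apply: integrableZl => //; apply: integrableS f_int => //.
have [||ik _ ck] := dominated_convergence mB mF mG _ iK _.
- by apply: aeW => y _; exact: cF.
- apply: aeW => y n yr; rewrite gee0_abs ?lee_fin ?conv_ratio_ge0//.
  by apply: HK.
split; last first.
  rewrite -(cvg_shiftn N); exact: ck.
have /integrableP[_] := ik; congr (_ < _); apply: eq_integral => y _.
by rewrite gee0_abs// lee_fin exp_weight_ge0.
Qed.

Lemma cvg_integral_eball_ratio theta gamma r : enorm theta = 1%R -> (0 <= r)%R ->
  exp_tail theta gamma f ->
  exp_int (eball d r) theta gamma < +oo /\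
  \int[leb]_(y in eball d r) (conv_ratio (t *: theta) y)%:E @[t --> +oo%R] -->
    exp_int (eball d r) theta gamma.
Proof.
move=> th1 r0 ft; split.
  (* Finiteness does not depend on the sequence; u n = n serves. *)
  by have [] := cvgn_integral_eball_ratio th1 r0 ft (@cvgr_idn R).
apply/cvge_pinftyP => u uoo.
by have [_] := cvgn_integral_eball_ratio th1 r0 ft uoo.
Qed.

Lemma self_conv_ratio x :
  self_conv f x * ((f x)^-1)%:E = \int[leb]_y (conv_ratio x y)%:E.
Proof.
have mff : measurable_fun setT ((fun y => (f (x - y) * f y)%:E) : lrV R d -> \bar R).
  apply/measurable_EFinP; apply: measurable_funM; last exact: measurable_density.
  exact: measurableT_comp measurable_density (lebesgue_measurable_subl x).
have fV0 : 0 <= ((f x)^-1)%:E by rewrite lee_fin invr_ge0.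
rewrite /self_conv muleC -(ge0_integralZl leb measurableT mff _ fV0); last first.
  by move=> y _; rewrite lee_fin mulr_ge0.
by apply: eq_integral => y _; rewrite -EFinM mulrC.
Qed.

Lemma far_integral_le_Kf r x : (1 <= enorm x)%R -> far_integral r x <= Kf f r.
Proof. by move=> x1; apply: ereal_sup_ubound; exists x. Qed.

(** * The two implications for a fixed direction *)

Section equivalence.
Variables (theta : 'rV[R]_d) (gamma : R).
Hypothesis th1 : enorm theta = 1%R.
Hypothesis ft : exp_tail theta gamma f.

Let A i t := \int[leb]_(y in eball d i%:R) (conv_ratio (t *: theta) y)%:E.
Let S t := \int[leb]_y (conv_ratio (t *: theta) y)%:E.
Let h (i : nat) := exp_int (eball d i%:R) theta gamma.

Let enT t : (0 <= t)%R -> enorm (t *: theta) = t.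
Proof. by move=> t0; rewrite enormZ th1 mulr1 ger0_norm. Qed.

Let h_fin i : h i \is a fin_num.
Proof.
have [hi _] := cvg_integral_eball_ratio th1 (ler0n R i) ft.
by rewrite ge0_fin_numE//; apply: integral_ge0 => y _; rewrite lee_fin exp_weight_ge0.
Qed.

Let near_A i e : (0 < e)%R ->
  \forall t \near +oo%R, A i t \is a fin_num /\ (`|fine (h i) - fine (A i t)| <= e)%R.
Proof.
move=> e0; have [_] := cvg_integral_eball_ratio th1 (ler0n R i) ft.
rewrite -[exp_int _ _ _](fineK (h_fin i)) => /fine_cvgP[fi /cvgrPdist_le/(_ _ e0) ci].
by near=> t; split; near: t.
Unshelve. all: by end_near. Qed.

Let near_S i : \forall t \near +oo%R, S t = 2%:E * A i t + far_integral i%:R (t *: theta).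
Proof.
near=> t; have t0 : (0 <= t)%R by near: t; apply: nbhs_pinfty_ge; rewrite num_real.
by apply: integral_conv_ratio; rewrite enT.
Unshelve. all: by end_near. Qed.

Let measurable_weight : measurable_fun setT
  ((fun y => (exp_weight gamma theta y)%:E) : lrV R d -> \bar R).
Proof. by apply/measurable_EFinP; exact: measurable_exp_weight. Qed.

Let weight_ge0 y : 0 <= (exp_weight gamma theta y)%:E.
Proof. by rewrite lee_fin exp_weight_ge0. Qed.

Lemma Kf_cvg0 : exp_moment theta gamma f < +oo ->
  S t @[t --> +oo%R] --> 2%:E * exp_moment theta gamma f ->
  Kf f r @[r --> +oo%R] --> 0.
Proof.
move=> hoo cS.
have hfin : exp_moment theta gamma f \is a fin_num.
  by rewrite ge0_fin_numE//; apply: integral_ge0 => y _; exact: weight_ge0.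
have Kge0 r : 0 <= Kf f r.
  apply: le_trans (far_integral_le_Kf r (x := theta) _); first exact: far_integral_ge0.
  by rewrite th1.
suff Ksmall e : (0 < e)%R -> \forall r \near +oo%R, Kf f r <= e%:E.
  apply/fine_cvgP; split.
    near=> r; rewrite ge0_fin_numE//; apply: (@le_lt_trans _ _ 1%:E); last exact: ltry.
    by near: r; exact: Ksmall.
  apply/cvgrPdist_le => e e0; near=> r.
  have : Kf f r <= e%:E by near: r; exact: Ksmall.
  have := Kge0 r; rewrite /= sub0r normrN.
  by case: (Kf f r) => [a| |]//=; rewrite !lee_fin => a0 ae; rewrite ger0_norm.
(* Write H for the full exponential moment. In I_i(t theta) = S - 2A, the error is [e1] from S, 2
   [e1] from 2A, and 2 [e1] from replacing 2H by 2h, which makes 5 [e1]. Rotation to the half-line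
   then costs C^3. *)
move=> e0; pose e1 := (e / (5 * C ^+ 3))%R.
have e10 : (0 < e1)%R by rewrite divr_gt0// mulr_gt0// exprn_gt0.
have [i hi] := integral_eballC_small measurable_weight weight_ge0 e10 hoo.
have hhi : (fine (exp_moment theta gamma f) <= fine (h i) + e1)%R.
  rewrite -lee_fin EFinD !fineK//.
  by rewrite /exp_moment (integral_eballC measurable_weight weight_ge0 i%:R) leeD2l.
have farT : \forall t \near +oo%R, far_integral i%:R (t *: theta) <= (5 * e1)%:E.
  have /fine_cvgP[fS /cvgrPdist_le/(_ _ e10) dS] :
      S t @[t --> +oo%R] --> (2 * fine (exp_moment theta gamma f))%:E.
    by rewrite EFinM fineK.
  near=> t.
  have [fA dA] : A i t \is a fin_num /\ (`|fine (h i) - fine (A i t)| <= e1)%R.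
    by near: t; exact: near_A.
  have fSt : S t \is a fin_num by near: t.
  have dSt : (`|2 * fine (exp_moment theta gamma f) - fine (S t)| <= e1)%R by near: t.
  have : S t = 2%:E * A i t + far_integral i%:R (t *: theta) by near: t; exact: near_S.
  rewrite -(fineK fSt) -(fineK fA) -EFinM.
  case: (far_integral _ _) => [b [E]| |]//; rewrite lee_fin.
  by move: dSt dA; rewrite !ler_norml => /andP[? ?] /andP[? ?]; lra.
have [T [T1 HT]] : exists T, (1 <= T)%R /\ forall t, (T <= t)%R ->
    far_integral i%:R (t *: theta) <= (5 * e1)%:E.
  (* The [M + 1] turns the strict bound t > M into a weak one; the 1 meets the requirement of
     [far_integral_bounded]. *)
  have [M [_ HM]] := farT; exists (Num.max 1 (M + 1))%R; split.
    by rewrite le_max lexx.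
  by move=> t; rewrite ge_max => /andP[_ Mt]; apply: HM; apply: lt_le_trans Mt; rewrite ltrDl.
have [r0 Hr0] := far_integral_bounded th1 T1 e0.
near=> r; apply: ge_ereal_sup => _ [x /= x1 <-]; rewrite -/(far_integral r x).
have r0r : (r0 <= r)%R by near: r; apply: nbhs_pinfty_ge; rewrite num_real.
have ir : (i%:R <= r)%R by near: r; apply: nbhs_pinfty_ge; rewrite num_real.
(* Bounded x are covered by the choice of [r0]; the others are rotated to the half-line at radius i,
   using i <= r. *)
have [xT|Tx] := leP (enorm x) T; first by apply: Hr0; rewrite ?x1.
apply: (le_trans (le_far_integral x ir)).
have x0 : (0 < enorm x)%R by lra.
have xx : enorm x = enorm (enorm x *: theta) by rewrite enT// ltW.
apply: (le_trans (far_integral_rotate (ler0n R i) x0 xx)).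
apply: (@le_trans _ _ ((C ^+ 3)%:E * (5 * e1)%:E)).
  by rewrite lee_wpmul2l ?lee_fin ?exprn_ge0 ?(ltW C_gt0)//; apply: HT; exact: ltW.
rewrite -EFinM lee_fin /e1 le_eqVlt; apply/orP; left; apply/eqP.
by field; exact: lt0r_neq0.
Unshelve. all: by end_near. Qed.

(** Finiteness of the exponential moment has to be derived: the moment over any large ball exceeds
    that over a fixed ball of radius m by at most a multiple of a bound on [Kf f m%:R]. Only then is
    S compared with twice the full moment. *)
Lemma cvg_self_conv : Kf f r @[r --> +oo%R] --> 0 ->
  exp_moment theta gamma f < +oo /\
  S t @[t --> +oo%R] --> 2%:E * exp_moment theta gamma f.
Proof.
move=> K0.
have Ksmall e : (0 < e)%R -> exists m : nat, Kf f m%:R <= e%:E.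
  move=> e0; have /fine_cvgP[fK /cvgrPdist_le/(_ _ e0) dK] := K0.
  have [T [_ HT]] : \forall r \near +oo%R, Kf f r <= e%:E.
    near=> r; have fKr : Kf f r \is a fin_num by near: r.
    have : (`|0 - fine (Kf f r)| <= e)%R by near: r.
    rewrite sub0r normrN -(fineK fKr) lee_fin; exact/le_trans/ler_norm.
  exists (Num.truncn T).+1; apply: HT; exact: truncnS_gt.
have far_small e m : Kf f m%:R <= e%:E -> \forall t \near +oo%R,
    far_integral m%:R (t *: theta) <= e%:E.
  move=> Km; near=> t; apply: le_trans Km; apply: far_integral_le_Kf.
  have t1 : (1 <= t)%R by near: t; apply: nbhs_pinfty_ge; rewrite num_real.
  by rewrite enT// (le_trans _ t1).
(* The 3e is one e for each of the approximations of h_i and h_m along the half-line and one for the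
   far integral. Letting i tend to infinity replaces h_i by the full moment. *)
have h_le e m : (0 < e)%R -> Kf f m%:R <= e%:E ->
    exp_moment theta gamma f <= (fine (h m) + 3 * e)%:E.
  move=> e0 Km; apply: cvge_le (cvg_integral_eball measurable_weight weight_ge0).
  near=> i; rewrite -[X in X <= _]/(h i) -(fineK (h_fin i)) lee_fin.
  suff [t [[fAi dAi] [fAm dAm] Ft At]] : exists t,
      [/\ A i t \is a fin_num /\ (`|fine (h i) - fine (A i t)| <= e)%R,
          A m t \is a fin_num /\ (`|fine (h m) - fine (A m t)| <= e)%R,
          far_integral m%:R (t *: theta) <= e%:E &
          A i t <= A m t + far_integral m%:R (t *: theta)].
    have : A i t <= A m t + e%:E by apply: (le_trans At); rewrite leeD2l.
    rewrite -(fineK fAi) -(fineK fAm) -EFinD lee_fin.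
    by move: dAi dAm; rewrite !ler_norml => /andP[? ?] /andP[? ?]; lra.
  suff : \forall t \near +oo%R, A i t <= A m t + far_integral m%:R (t *: theta).
    move=> At; have Aie := near_A i e0; have Ame := near_A m e0; have Fe := far_small _ _ Km.
    near (pinfty_nbhs R) => t; exists t.
    by split; near: t.
  near=> t.
  have t0 : (0 <= t)%R by near: t; apply: nbhs_pinfty_ge; rewrite num_real.
  have imt : (i%:R + m%:R < t)%R by near: t; apply: nbhs_pinfty_gt; rewrite num_real.
  have mBm : measurable (eball d m%:R : set (lrV R d)) by exact: lebesgue_measurable_eball.
  have mfar := measurable_far m%:R (t *: theta).
  (* For t > i + m, a point y of the ball of radius i has |t theta - y| > m, so it lies either in
     the ball of radius m or in the far region. *)
  rewrite /A /far_integral -ge0_integral_setU//.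
  - apply: ge0_subset_integral.
    + exact: lebesgue_measurable_eball.
    + exact: measurableU.
    + exact: measurable_ratio.
    + by move=> y _; rewrite lee_fin conv_ratio_ge0.
    move=> y yi; have [ym|my] := leP (enorm (y : 'rV[R]_d)) m%:R; [by left|right; split => //].
    apply: lt_le_trans (ler_enormB _ _); rewrite enT//.
    by move: yi; rewrite /eball /=; lra.
  - by move=> y _; rewrite lee_fin conv_ratio_ge0.
  - by rewrite disj_set2E; apply/eqP; rewrite -subset0 => y [] /= ym [_]; rewrite ltNge ym.
have hoo : exp_moment theta gamma f < +oo.
  by have [m Km] := Ksmall _ ltr01; exact: le_lt_trans (h_le _ _ ltr01 Km) (ltry _).
split => //.
have hfin : exp_moment theta gamma f \is a fin_num.
  by rewrite ge0_fin_numE//; apply: integral_ge0 => y _; exact: weight_ge0.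
have h_ge m : (fine (h m) <= fine (exp_moment theta gamma f))%R.
  rewrite -lee_fin !fineK//; apply: ge0_subset_integral => //.
  exact: lebesgue_measurable_eball.
rewrite -(fineK hfin) -EFinM.
have near_S_all e : (0 < e)%R -> \forall t \near +oo%R, S t \is a fin_num /\
    (`|2 * fine (exp_moment theta gamma f) - fine (S t)| <= e)%R.
  (* In ninths of e: 2H - 2h is at most 6 by [h_le], 2h - 2A at most 2, and the far integral at most
     1. *)
  move=> e0; have e10 : (0 < e / 9)%R by rewrite divr_gt0.
  have [m Km] := Ksmall _ e10; have := h_le _ _ e10 Km; rewrite -(fineK hfin) lee_fin => hm.
  have Fe := far_small _ _ Km; have := h_ge m => hm'.
  near=> t.
  have [fA dA] : A m t \is a fin_num /\ (`|fine (h m) - fine (A m t)| <= e / 9)%R.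
    by near: t; exact: near_A.
  have : far_integral m%:R (t *: theta) <= (e / 9)%:E by near: t.
  have : S t = 2%:E * A m t + far_integral m%:R (t *: theta) by near: t; exact: near_S.
  have := far_integral_ge0 m%:R (t *: theta).
  case: (far_integral _ _) => [b| |]//; rewrite !lee_fin -(fineK fA) -EFinM -EFinD.
  move=> b0 -> be; split => //=; move: dA; rewrite !ler_norml => /andP[? ?].
  by apply/andP; split; lra.
apply/fine_cvgP; split.
  by apply: filterS (near_S_all _ ltr01) => t [].
by apply/cvgrPdist_le => e e0; apply: filterS (near_S_all _ e0) => t [].
Unshelve. all: by end_near. Qed.

End equivalence.

End convolution_ratio.

(** Chain f(x) <= c g(|x|) <= c g(|y|) <= c^2 f(y), so that [g] disappears and C = c^2. *)
Lemma almost_radial_decreasing_le (R : realType) d (f : 'rV[R]_d -> R) :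
  almost_radial_decreasing f ->
  exists C : R, [/\ 1 <= C, forall x, x != 0 -> 0 < f x &
    forall x y, y != 0 -> enorm y <= enorm x -> f x <= C * f y].
Proof.
move=> [g [c [g0 gdec c1 gf]]]; have c0 : 0 < c by exact: lt_le_trans c1.
have en0 (x : 'rV[R]_d) : x != 0 -> 0 < enorm x.
  by move=> x0; rewrite lt0r enorm_ge0 andbT; apply: contra_neq x0; exact: enorm0_eq0.
exists (c ^+ 2); split.
- by rewrite exprn_ege1.
- move=> x x0; have [+ _] := gf x x0; apply: lt_le_trans.
  by rewrite mulr_gt0 ?invr_gt0// g0// en0.
move=> x y y0 yx; have x0 : x != 0.
  by apply: enorm_gt0_neq0; apply: lt_le_trans yx; exact: en0.
have [_ fx] := gf x x0; have [fy _] := gf y y0.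
apply: (le_trans fx); rewrite expr2 -mulrA ler_wpM2l// ?(ltW c0)//.
apply: (@le_trans _ _ (g (enorm y))); first by apply: gdec => //; exact: en0.
by rewrite -ler_pdivrMl.
Qed.

Unset Implicit Arguments.
Set Strict Implicit.

Theorem corollary1p4 (R : realType) (d : nat) (hd : (1 <= d)%N)
  (f : 'rV[R]_d -> R) (f_density : density f)
  (f_ard : almost_radial_decreasing f)
  (theta : 'rV[R]_d) (theta_sphere : enorm theta = 1)
  (gamma : R) (gamma_ge0 : 0 <= gamma)
  (f_tail : exp_tail theta gamma f) :
  subexp_class theta gamma f <-> Kf f r @[r --> +oo] --> 0%E.
Proof.
have [f_int f_ge0 _] := f_density.
have [C [C1 f_gt0 f_le]] := almost_radial_decreasing_le f_ard.
have SE t : (self_conv f (t *: theta) * (f (t *: theta))^-1%:E =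
    \int[lebesgue_rV R d]_y (conv_ratio f (t *: theta) y)%:E)%E.
  exact: self_conv_ratio.
split=> [[_ _ _ hoo cS]|K0].
  apply: (Kf_cvg0 f_int f_ge0 f_gt0 C1 f_le theta_sphere f_tail hoo).
  by under eq_fun do rewrite -SE.
have [hoo cS] := cvg_self_conv f_int f_ge0 f_gt0 C1 f_le theta_sphere f_tail K0.
split => //; last by under eq_fun do rewrite SE.
(* Any positive threshold would do: t theta is nonzero and [f] is positive away from the origin. *)
exists 1; split => // t t1; apply: f_gt0; apply: enorm_gt0_neq0.
by rewrite enormZ theta_sphere mulr1 normr_gt0 gt_eqF// (lt_le_trans ltr01).
Qed.
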